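(* Let $\alpha\in(0,1)$ and $U_\alpha^{\mathrm{NP}}(x)=\min(x,1/\alpha)$ for $x\in[0,\infty]$. For every collection $H$ of probability measures on a measurable space $\mathcal{X}$ and every probability measure $Q$ on $\mathcal{X}$, a $U_\alpha^{\mathrm{NP}}$-optimal e-value exists and can be chosen to take values in $[0,1/\alpha]$. For a valid e-value $\varepsilon^{\mathrm{NP}}\in\mathcal{E}(H)$ taking values in $[0,1/\alpha]$, the following statements are equivalent: 1. $\varepsilon^{\mathrm{NP}}$ is $U_\alpha^{\mathrm{NP}}$-optimal; 2. there exist some $P^*\in H^{\mathrm{eff}}$ with $P^*\ll Q_a$ and $\lambda^*\in[0,\infty)$ such that, $Q_a$-almost surely, $$\varepsilon^{\mathrm{NP}}(x)=\begin{cases}1/\alpha, & \text{if } \lambda^*\,\frac{dP^*}{dQ_a}(x)<1,\\ \kappa_\alpha(x), & \text{if } \lambda^*\,\frac{dP^*}{dQ_a}(x)=1,\\ 0, & \text{if } \lambda^*\,\frac{dP^*}{dQ_a}(x)>1,\end{cases}$$ where $\kappa_\alpha:\mathcal{X}\to[0,1/\alpha]$ is measurable, and $\lambda^*(\mathrm{E}^{P^*}[\varepsilon^{\mathrm{NP}}]-1)=0$.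
   Context: Notation: $\mathrm{E}^\mu[f]=\int f\,d\mu$ for any nonnegative measure $\mu$; Radon--Nikodym derivatives are taken $[0,\infty)$-valued. An event is $H$-negligible if it has probability zero under every $P\in H$. $Q=Q_a+Q_s$ denotes the generalized Lebesgue decomposition of $Q$ with respect to $H$: the nonnegative measure $Q_s$ is concentrated on an $H$-negligible event and the nonnegative measure $Q_a$ assigns zero mass to every $H$-negligible event. The class of valid e-values for $H$ is $\mathcal{E}(H)=\{\varepsilon:\mathcal{X}\to[0,\infty]\ \text{measurable}: \mathrm{E}^P[\varepsilon]\le 1\ \text{for all } P\in H\}$. With $M_+$ the collection of nonnegative measures on $\mathcal{X}$, the effective hypothesis is $H^{\mathrm{eff}}=\{P\in M_+: \mathrm{E}^P[\varepsilon]\le 1\ \text{for all } \varepsilon\in\mathcal{E}(H)\}$. For measurable $U:[0,\infty]\to[-\infty,\infty]$, a valid e-value $\varepsilon^*\in\mathcal{E}(H)$ is $U$-optimal (against $Q_a$) if, for every $\varepsilon\in\mathcal{E}(H)$, $\mathrm{E}^{Q_a}[U(\varepsilon^* )-U(\varepsilon)]$ is well-defined and $\ge 0$. Here ''well-defined'' means that the integrand avoids an ambiguous $\infty-\infty$ $Q_a$-almost surely, and that its positive part or its negative part has finite $Q_a$-expectation. *)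

(* Defs.v *)
From HB Require Import structures.
From mathcomp Require Export all_boot all_order all_algebra.
From mathcomp Require Export all_classical all_reals all_analysis.
From mathcomp Require Export measurable_realfun.

Set Implicit Arguments.
Unset Strict Implicit.
Unset Printing Implicit Defensive.

Import Order.TTheory GRing.Theory Num.Theory.
Import numFieldNormedType.Exports.

Local Open Scope classical_set_scope.
Local Open Scope ring_scope.
Local Open Scope ereal_scope.

Section evalues.
Context {d : measure_display} {X : measurableType d} {R : realType}.
Implicit Types (H : set (probability X R)) (e : X -> \bar R).

Definition hyp_negligible H (N : set X) : Prop :=
  measurable N /\ forall P, H P -> P N = 0.

Definition generalized_lebesgue_decomposition H
    (Q Qa Qs : set X -> \bar R) : Prop :=
  [/\ forall A, measurable A -> Q A = Qa A + Qs A,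
      exists2 N, hyp_negligible H N & Qs (~` N) = 0 &
      forall N, hyp_negligible H N -> Qa N = 0].

Definition e_value H e : Prop :=
  [/\ measurable_fun [set: X] e,
      forall x, 0 <= e x &
      forall P, H P -> \int[P]_x e x <= 1].

(* Every element has mass at most 1 (see [effective_hypothesis_le1]), hence
   bundling one as a [{finite_measure}], as the library's Radon-Nikodym
   derivative requires, loses nothing. *)
Definition effective_hypothesis H : set {measure set X -> \bar R} :=
  [set P | forall e, e_value H e -> \int[P]_x e x <= 1].

(* The value of [- +oo + +oo] in [\bar R] is conventional, as is that of the
   integral when both parts have infinite mass, so both cases are excluded
   explicitly; [x +? y] says that [x + y] is not of the form [oo - oo]. *)
Definition expectation_well_defined (mu : {measure set X -> \bar R})
    (f g : X -> \bar R) : Prop :=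
  {ae mu, forall x, f x +? - g x} /\
  (\int[mu]_x (f \- g)^\+ x < +oo \/ \int[mu]_x (f \- g)^\- x < +oo).

(* [U] is only ever evaluated on [0, +oo]. *)
Definition U_optimal (U : \bar R -> \bar R) H (Qa : {measure set X -> \bar R})
    (estar : X -> \bar R) : Prop :=
  e_value H estar /\
  forall e, e_value H e ->
    expectation_well_defined Qa (U \o estar) (U \o e) /\
    0 <= \int[Qa]_x (U (estar x) - U (e x)).

Definition U_NP (alpha : R) (x : \bar R) : \bar R := mine x (alpha^-1)%:E.

Lemma e_value1 H : e_value H (cst 1).
Proof.
split=> [|//|P _]; first exact: measurable_cst.
by rewrite integral_cst// mul1e; exact: probability_le1.
Qed.

Lemma effective_hypothesis_le1 H (P : {measure set X -> \bar R}) :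
  effective_hypothesis H P -> P setT <= 1.
Proof. by move=> /(_ _ (e_value1 H)); rewrite integral_cst// mul1e. Qed.

(* So quantifying over all decompositions of [Q] is never vacuous. *)
Lemma generalized_lebesgue_decomposition_exists H (Q : probability X R) :
  exists Qa Qs : {finite_measure set X -> \bar R},
    generalized_lebesgue_decomposition H Q Qa Qs.
Proof.
pose S := [set Q N | N in hyp_negligible H].
have neg0 : hyp_negligible H set0 by split=> // P _; rewrite measure0.
have Sle y : S y -> y <= ereal_sup S by exact: ereal_sup_ubound.
have supfin : ereal_sup S \is a fin_num.
  rewrite ge0_fin_numE.
    apply: (@le_lt_trans _ _ 1); last exact: ltry.
    by apply: ge_ereal_sup => _ [N [mN _] <-]; exact: probability_le1.
  by apply: Sle; exists set0 => //; rewrite measure0.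
have nearN n : exists N, hyp_negligible H N /\
    ereal_sup S - (n.+1%:R^-1)%:E < Q N.
  have n0 : (0 < n.+1%:R^-1 :> R)%R by rewrite invr_gt0.
  by have [_ [N hN <-] ltN] := ub_ereal_sup_adherent n0 supfin; exists N.
have [F hF] := choice nearN.
pose N := \bigcup_n F n.
have mF n : measurable (F n) by have [[]] := hF n.
have mN : measurable N by exact: bigcup_measurable.
have hN : hyp_negligible H N.
  split=> // P HP; apply/eqP; rewrite -measure_le0.
  apply: (le_trans (measure_sigma_subadditive P mF mN (@subset_refl _ N))).
  by rewrite eseries0// => n _ _; have [[_ /(_ P HP)]] := hF n.
have supN : ereal_sup S <= Q N.
  apply/lee_addgt0Pr => _/posnumP[eps].
  have [n _ neps] := near_infty_natSinv_lt eps.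
  have {}neps := neps n (leqnn n).
  have [_ /ltW] := hF n; rewrite leeBlDr// => /le_trans; apply.
  apply: leeD; last by rewrite lee_fin ltW.
  by apply: le_measure; rewrite ?inE//; exact: bigcup_sup.
have Qfin (A : set X) : measurable A -> Q A < +oo.
  by move=> mA; exact: le_lt_trans (probability_le1 _ mA) (ltry _).
exists (mfrestr (measurableC mN) (Qfin _ (measurableC mN))).
exists (mfrestr mN (Qfin _ mN)).
split.
- move=> A mA; by rewrite (measureDI Q mA mN) setDE.
- by exists N => //; rewrite /= /mfrestr /mrestr setICl measure0.
- move=> M hM; have mM : measurable M by case: hM.
  have hU : hyp_negligible H (M `|` N).
    split=> [|P HP]; first exact: measurableU.
    by apply: null_set_setU => //; [exact: (proj2 hM) | exact: (proj2 hN)].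
  have QU : Q (M `|` N) <= Q N by apply: le_trans supN; apply: Sle; exists (M `|` N).
  have mMN : measurable (M `&` ~` N) by apply: measurableI => //; exact: measurableC.
  have UE : M `|` N = N `|` (M `&` ~` N).
    by rewrite setUIr setUv setIT setUC.
  apply/eqP; rewrite -measure_le0 -(@leeD2lE _ (Q N)) ?fin_num_measure// adde0.
  apply: le_trans QU; rewrite UE measureU//.
  by rewrite setICA setICr setI0.
Qed.
End evalues.

(* Main.v *)
Require Import Defs.
From mathcomp Require Import ring lra.
Import Order.TTheory GRing.Theory Num.Theory.
Import numFieldNormedType.Exports.
Local Open Scope classical_set_scope.
Local Open Scope ring_scope.
Set Implicit Arguments.
Unset Strict Implicit.
Unset Printing Implicit Defensive.

(** Write c for 1/alpha and mu for Qa. For e-values bounded by c the utility is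
    the identity, so optimality of eps says that the integral of eps is at least
    that of min(e, c) for every bounded e-value e ([U_optimal_NPP]).

    A maximizer exists by weak compactness, in the form of
    [convex_class_compactness]: near-minimizers of the L2 norm on a decreasing
    sequence of convex sets are Cauchy by the parallelogram law, so that a
    subsequence converges mu-almost everywhere. Here the sets consist of the
    [0, c]-valued e-values whose integral is close to the supremum. The limit is
    taken to be the pointwise lower limit at every point; Fatou's lemma then
    applies under every P in H, dominated by mu or not, and shows that the limit
    is again an e-value.

    If r denotes lambda dP/dmu, the three cases of the Neyman-Pearson shape
    amount to (eps - e)(1 - r) >= 0 for every [0, c]-valued e. Integrated against
    mu, this bounds the integral of eps - e from below by lambda times its
    P-integral, which is nonnegative by complementary slackness and because P
    is in the effective hypothesis ([optimal_of_multiplier]).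

    Conversely, an optimal eps requires a multiplier: a function g into [0, 1],
    equal to 1 where eps < c, such that the integral of g (e - eps) is at most 0
    for all bounded e-values e. It is a supergradient at eps of the integral of
    min(., c) that supports the set of e-values at eps. To construct it, the hinge
    max(0, c - x) is replaced by a differentiable function whose slope is the
    opposite of a function ramp with values in [0, 1]. If e nearly minimizes the
    smoothed problem among the e-values below a bound, the first-order condition
    says that ramp(e) is nearly a multiplier ([approximate_multiplier]). The sets
    of approximate multipliers are convex and decrease with the tolerance, so the
    same compactness argument yields an exact one ([exact_multiplier]).

    Let then lambda be the integral of g eps, and P the measure of density g /
    lambda with respect to mu. The support inequality says that P integrates bounded
    e-values to at most 1, hence all e-values by monotone convergence
    ([effective_hypothesisP]); and lambda dP/dmu = g. When lambda = 0, testing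
    against the e-value 1 shows that g vanishes almost everywhere, so with
    the convention 0^-1 = 0 the same formulas hold for P = 0
    ([multiplier_of_optimal]). *)

(** * Bounded measurable functions *)

Section bounded_measurable.
Context {d : measure_display} {X : measurableType d} {R : realType}.
Implicit Types f g : X -> R.

Definition bounded_measurable f :=
  measurable_fun [set: X] f /\ exists M, forall x, `|f x| <= M.

Lemma bounded_measurable_cst r : bounded_measurable (fun=> r).
Proof. by split; [exact: measurable_cst | exists `|r|]. Qed.

Lemma bounded_measurable_range M f : measurable_fun [set: X] f ->
  (forall x, 0 <= f x <= M) -> bounded_measurable f.
Proof.
by move=> mf fM; split=> //; exists M => x; have /andP[f0 ?] := fM x; rewrite ger0_norm.
Qed.

Lemma bounded_measurableD f g : bounded_measurable f -> bounded_measurable g ->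
  bounded_measurable (fun x => f x + g x).
Proof.
move=> [mf [M fM]] [mg [N gN]]; split; first exact: measurable_funD.
by exists (M + N) => x; rewrite (le_trans (ler_normD _ _))// lerD.
Qed.

Lemma bounded_measurableM f g : bounded_measurable f -> bounded_measurable g ->
  bounded_measurable (fun x => f x * g x).
Proof.
move=> [mf [M fM]] [mg [N gN]]; split; first exact: measurable_funM.
by exists (M * N) => x; rewrite normrM ler_pM.
Qed.

Lemma bounded_measurableX f n : bounded_measurable f ->
  bounded_measurable (fun x => f x ^+ n).
Proof.
move=> bf; elim: n => [|n IH].
  by under eq_fun do rewrite expr0; exact: bounded_measurable_cst.
by under eq_fun do rewrite exprS; exact: bounded_measurableM.
Qed.

Lemma bounded_measurableN f : bounded_measurable f ->
  bounded_measurable (fun x => - f x).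
Proof.
move=> [mf [M fM]]; split; first exact: measurableT_comp.
by exists M => x; rewrite normrN.
Qed.

Lemma bounded_measurable_norm f : bounded_measurable f ->
  bounded_measurable (fun x => `|f x|).
Proof.
move=> [mf [M fM]]; split; first exact: measurableT_comp.
by exists M => x; rewrite normr_id.
Qed.

Lemma bounded_measurable_min f g : bounded_measurable f -> bounded_measurable g ->
  bounded_measurable (fun x => Num.min (f x) (g x)).
Proof.
move=> [mf [M fM]] [mg [N gN]]; split; first exact: measurable_minr.
exists (Num.max M N) => x; rewrite le_max /Num.min.
by case: ifP => _; rewrite ?fM ?gN ?orbT.
Qed.

Lemma bounded_measurable_max f g : bounded_measurable f -> bounded_measurable g ->
  bounded_measurable (fun x => Num.max (f x) (g x)).
Proof.
move=> [mf [M fM]] [mg [N gN]]; split; first exact: measurable_maxr.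
exists (Num.max M N) => x; rewrite le_max /Num.max.
by case: ifP => _; rewrite ?fM ?gN ?orbT.
Qed.

Variable mu : {finite_measure set X -> \bar R}.

Lemma bounded_measurable_integrable f : bounded_measurable f ->
  mu.-integrable [set: X] (EFin \o f).
Proof.
move=> [mf [M fM]]; apply: measurable_bounded_integrable => //.
  by rewrite -ge0_fin_numE ?fin_num_measure.
by exists M; split; [exact: num_real | move=> N MN x _; exact: le_trans (fM x) (ltW MN)].
Qed.

End bounded_measurable.

(** The functions integrated below are built from bounded measurable ones by
    arithmetic operations, so their integrability can be read off their syntax. *)
Ltac bm_step := match goal with
  | H : ?P |- ?P => exact H
  | |- measurable _ => exact: measurableT
  | H : forall x, bounded_measurable _ |- _ => solve [apply: H]
  | |- is_true (integrable _ _ _) => apply: bounded_measurable_integrable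
  | |- bounded_measurable (fun x => @?f x + @?g x) => apply: (@bounded_measurableD _ _ _ f g)
  | |- bounded_measurable (fun x => - @?f x) => apply: (@bounded_measurableN _ _ _ f)
  | |- bounded_measurable (fun x => @?f x * @?g x) => apply: (@bounded_measurableM _ _ _ f g)
  | |- bounded_measurable (fun x => @?f x ^+ ?n) => apply: (@bounded_measurableX _ _ _ f n)
  | |- bounded_measurable (fun x => `|@?f x|) => apply: (@bounded_measurable_norm _ _ _ f)
  | |- bounded_measurable (fun x => Num.min (@?f x) (@?g x)) =>
      apply: (@bounded_measurable_min _ _ _ f g)
  | |- bounded_measurable (fun x => Num.max (@?f x) (@?g x)) =>
      apply: (@bounded_measurable_max _ _ _ f g)
  | |- bounded_measurable (fun x => ?c) => exact: bounded_measurable_cst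
  end.
Ltac bm := solve [repeat bm_step].

(** * Compactness of decreasing convex classes *)

Definition convex_class {X : Type} {R : realType} (C : set (X -> R)) :=
  forall (t : R) f g, 0 <= t <= 1 -> C f -> C g ->
    C (fun x => (1 - t) * f x + t * g x).

Section subsequences.
Context {d : measure_display} {X : measurableType d} {R : realType}.
Variable mu : {finite_measure set X -> \bar R}.
Implicit Types (f g h : X -> R).

(** The midpoint of f and g is in C, so its squared norm is at least m; by the
    parallelogram law two near-minimizers of the norm are close. *)
Lemma parallelogram_near_min (C : set (X -> R)) f g (m r : R) :
    convex_class C -> (forall h, C h -> bounded_measurable h) ->
    (forall h, C h -> m <= \int[mu]_x (h x ^+ 2)) ->
    C f -> C g ->
    \int[mu]_x (f x ^+ 2) <= m + r -> \int[mu]_x (g x ^+ 2) <= m + r ->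
  \int[mu]_x ((f x - g x) ^+ 2) <= 4 * r.
Proof.
move=> cC bC mC Cf Cg fr gr.
have bf := bC _ Cf; have bg := bC _ Cg.
have half : 0 <= (2^-1 : R) <= 1 by lra.
have := mC _ (cC _ _ _ half Cf Cg).
have -> : \int[mu]_x (((1 - 2^-1) * f x + 2^-1 * g x) ^+ 2) =
    2^-1 * \int[mu]_x (f x ^+ 2) + 2^-1 * \int[mu]_x (g x ^+ 2)
    - 4^-1 * \int[mu]_x ((f x - g x) ^+ 2).
  rewrite -!RintegralZl; try bm.
  rewrite -RintegralD; try bm.
  rewrite -RintegralB; try bm.
  by apply: eq_Rintegral => x _; field.
lra.
Qed.

Variables (C : nat -> set (X -> R)) (M : R).
Hypothesis C0 : forall n, C n !=set0.
Hypothesis Cdec : forall n, C n.+1 `<=` C n.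
Hypothesis Cconv : forall n, convex_class (C n).
Hypothesis Cm : forall n f, C n f -> measurable_fun [set: X] f.
Hypothesis CM : forall n f, C n f -> forall x, 0 <= f x <= M.

Let Cb n f : C n f -> bounded_measurable f.
Proof. by move=> Cf; apply: (bounded_measurable_range (Cm Cf) (CM Cf)). Qed.

Let Cle m n : (m <= n)%N -> C n `<=` C m.
Proof.
elim: n => [|n IH]; first by rewrite leqn0 => /eqP ->.
rewrite leq_eqVlt => /predU1P[->//|]; rewrite ltnS => /IH mn f /Cdec; exact: mn.
Qed.

(** The infima of the squared norms over the C n increase to a finite supremum S. Along
    indices L k at which they have come within rho k of S, a near-minimizer on
    C (L k) and one on C (L k.+1) are both near-minimizers on C (L k). *)
Lemma near_min_norm_sequence : exists F : nat -> X -> R,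
  forall k, C k (F k) /\ \int[mu]_x ((F k x - F k.+1 x) ^+ 2) <= 4^-1 ^+ k.
Proof.
pose nsq f := \int[mu]_x (f x ^+ 2).
pose s n := inf [set nsq f | f in C n].
have nsq0 f : 0 <= nsq f by apply: Rintegral_ge0 => x _; exact: sqr_ge0.
have infS n : has_inf [set nsq f | f in C n].
  split; first by have [f Cf] := C0 n; exists (nsq f), f.
  by exists 0 => _ [f _ <-]; exact: nsq0.
have sC n f : C n f -> s n <= nsq f.
  by move=> Cf; apply: ge_inf; [exact: (infS n).2 | exists f].
have s_nd m n : (m <= n)%N -> s m <= s n.
  move=> mn; apply: lb_le_inf; first exact: (infS n).1.
  by move=> _ [f Cf <-]; apply: sC; exact: Cle Cf.
pose S := sup (range s).
have supS : has_sup (range s).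
  split; first by exists (s 0%N), 0%N.
  exists (\int[mu]_x (M ^+ 2)) => _ [n _ <-].
  have [f Cf] := C0 n; apply: le_trans (sC _ _ Cf) _.
  have bf := Cb Cf.
  apply: le_Rintegral; try bm.
  by move=> x _; have /andP[f0 fM] := CM Cf x; rewrite ler_sqr// nnegrE (le_trans f0).
have sS n : s n <= S by apply: sup_upper_bound => //; exists n.
pose rho k : R := 4^-1 ^+ k / 8.
have rho0 k : 0 < rho k by rewrite /rho divr_gt0// exprn_gt0// invr_gt0.
have rhoS k : rho k.+1 <= rho k by rewrite /rho exprS; have := rho0 k; rewrite /rho; lra.
have /choice[N NS] k : exists n, S - rho k < s n.
  by have [_ [n _ <-]] := sup_adherent (rho0 k) supS; exists n.
(* Summing the N j makes L nondecreasing while keeping k, N k <= L k. *)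
pose L k := (k + \sum_(j < k.+1) N j)%N.
have NL k : (N k <= L k)%N by rewrite /L big_ord_recr/= addnA leq_addl.
have LS k : (L k <= L k.+1)%N by rewrite /L [X in (_ <= _ + X)%N]big_ord_recr/= leq_add// leq_addr.
have /choice[F FP] k : exists f, C (L k) f /\ nsq f < s (L k) + rho k.
  by have [_ [f Cf <-]] := inf_adherent (rho0 k) (infS (L k)); exists f.
exists F => k; have [CF Fs] := FP k; have [CF' Fs'] := FP k.+1; split.
  by apply: Cle CF; exact: leq_addr.
have -> : 4^-1 ^+ k = 4 * (2 * rho k) by rewrite /rho; field.
apply: (@parallelogram_near_min (C (L k)) _ _ (S - rho k)) => //.
- exact: Cb.
- move=> h Ch; apply: le_trans (sC _ _ Ch); apply/ltW/(lt_le_trans (NS k)); exact: s_nd.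
- exact: Cle CF'.
- by have := sS (L k); move: Fs; rewrite /nsq; lra.
- by have := sS (L k.+1); have := rhoS k; move: Fs'; rewrite /nsq; lra.
Qed.

(** By the inequality |y| <= 2^-k + 2^k y^2, the L1 norms of the increments are
    summable too; hence the series of the absolute increments has a finite
    integral, and so a finite sum almost everywhere. *)
Lemma ae_cvg_of_geometric_increments (F : nat -> X -> R) :
    (forall k, bounded_measurable (F k)) ->
    (forall k, \int[mu]_x ((F k x - F k.+1 x) ^+ 2) <= 4^-1 ^+ k) ->
  {ae mu, forall x, cvgn (F ^~ x)}.
Proof.
move=> bF Fsq.
pose u k x : R := `|F k.+1 x - F k x|.
have bu k : bounded_measurable (u k) by rewrite /u; bm.
pose m : R := \int[mu]_x 1.
have m0 : 0 <= m by apply: Rintegral_ge0.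
have uint k : \int[mu]_x u k x <= (m + 1) * 2^-1 ^+ k.
  have p0 : 0 < 2^-1 ^+ k :> R by rewrite exprn_gt0// invr_gt0.
  have p4 : 4^-1 ^+ k = 2^-1 ^+ k * 2^-1 ^+ k :> R.
    by rewrite -exprMn; congr (_ ^+ _); field.
  have pV : 2 ^+ k * 2^-1 ^+ k = 1 :> R by rewrite -exprMn divff ?expr1n// pnatr_eq0.
  apply: (@le_trans _ _ (\int[mu]_x
      (2^-1 ^+ k * 1 + 2 ^+ k * (F k x - F k.+1 x) ^+ 2))).
    apply: le_Rintegral; try bm; move=> x _.
    rewrite /u distrC -(real_normK (num_real (_ - _))).
    move: `|F k x - F k.+1 x| => y.
    rewrite -subr_ge0.
    have -> : 2^-1 ^+ k * 1 + 2 ^+ k * y ^+ 2 - y =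
        2 ^+ k * ((2^-1 ^+ k - y / 2) ^+ 2 + 3 / 4 * y ^+ 2) +
        2^-1 ^+ k * (1 - 2 ^+ k * 2^-1 ^+ k) - y * (1 - 2 ^+ k * 2^-1 ^+ k) by field.
    rewrite pV subrr !mulr0 subr0 addr0 mulr_ge0 ?exprn_ge0// addr_ge0 ?sqr_ge0//.
    by rewrite mulr_ge0 ?sqr_ge0.
  rewrite RintegralD; try bm.
  rewrite !RintegralZl; try bm.
  rewrite -/m mulrDl mul1r [X in _ <= X + _]mulrC lerD2l.
  apply: (@le_trans _ _ (2 ^+ k * 4^-1 ^+ k)); first by rewrite ler_pM2l ?exprn_gt0.
  by rewrite p4 mulrA pV mul1r.
have uE k : (\int[mu]_x (u k x)%:E = (\int[mu]_x u k x)%:E)%E.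
  by rewrite /Rintegral fineK//; apply: integrable_fin_num => //; bm.
have sumE : (\int[mu]_x (\sum_(k <oo) (u k x)%:E) = \sum_(k <oo) \int[mu]_x (u k x)%:E)%E.
  apply: integral_nneseries => //.
  - by move=> k; apply/measurable_EFinP; exact: (bu k).1.
  - by move=> k x _; rewrite lee_fin normr_ge0.
have msum : measurable_fun [set: X] (fun x => \sum_(k <oo) (u k x)%:E)%E.
  apply: ge0_emeasurable_sum => //.
  - by move=> k x _ _; rewrite lee_fin normr_ge0.
  - by move=> k _; apply/measurable_EFinP; exact: (bu k).1.
have isum : mu.-integrable [set: X] (fun x => \sum_(k <oo) (u k x)%:E)%E.
  apply/integrableP; split=> //.
  have -> : (\int[mu]_x `|\sum_(k <oo) (u k x)%:E| = \int[mu]_x (\sum_(k <oo) (u k x)%:E))%E.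
    apply: eq_integral => x _; rewrite gee0_abs// nneseries_ge0// => k _ _.
    by rewrite lee_fin normr_ge0.
  rewrite sumE; apply: (@le_lt_trans _ _ ((m + 1) * 2)%:E); last exact: ltry.
  apply: lime_le.
    apply: is_cvg_nneseries => k _ _; rewrite uE lee_fin.
    by apply: Rintegral_ge0 => x _; exact: normr_ge0.
  apply: nearW => n.
  under eq_bigr do rewrite uE.
  rewrite sumEFin lee_fin.
  apply: (@le_trans _ _ (\sum_(0 <= k < n) (m + 1) * 2^-1 ^+ k)).
    by apply: ler_sum => k _; exact: uint.
  rewrite -big_distrr/= ler_wpM2l ?addr_ge0//.
  have -> : \sum_(0 <= k < n) 2^-1 ^+ k = 2 - 2 * 2^-1 ^+ n :> R.
    elim: n => [|n IH]; first by rewrite big_nil expr0; lra.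
    by rewrite big_nat_recr//= IH exprS; field.
  by rewrite lerBlDr lerDl mulr_ge0// exprn_ge0// invr_ge0.
have := integrable_ae measurableT isum.
apply: filterS => x /(_ Logic.I) xfin.
have cT : cvgn (series (telescope (F ^~ x))).
  apply: normed_cvg; apply: nondecreasing_is_cvgn.
    by apply/nondecreasing_series => k _ _; exact: normr_ge0.
  exists (fine (\sum_(k <oo) (u k x)%:E)%E) => _ [n _ <-].
  rewrite -lee_fin fineK// /series/= -sumEFin.
  by apply: nneseries_lim_ge => k _ _; rewrite lee_fin normr_ge0.
have -> : F ^~ x = (fun n => F 0%N x + series (telescope (F ^~ x)) n).
  by apply/funext => n; rewrite -eq_sum_telescope.
by apply: is_cvgD => //; exact: is_cvg_cst.
Qed.

End subsequences.

(** The lower limit of a bounded sequence of functions is defined at every point,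
    so it serves at once all the measures under which Fatou's lemma is applied. *)
Section lower_limit.
Context {d : measure_display} {X : measurableType d} {R : realType}.
Variables (F : nat -> X -> R) (M : R).
Hypothesis mF : forall k, measurable_fun [set: X] (F k).
Hypothesis FM : forall k x, 0 <= F k x <= M.

Definition lower_limit x : R := fine (limn_einf (fun k => (F k x)%:E)).

Let einf_range x : (0 <= limn_einf (fun k => (F k x)%:E) <= M%:E)%E.
Proof.
rewrite limn_einf_lim; apply/andP; split.
  apply: lime_ge; first exact: is_cvg_einfs.
  apply: nearW => n; apply: le_ereal_inf_tmp => _ [m _ <-].
  by rewrite lee_fin; have /andP[] := FM m x.
apply: lime_le; first exact: is_cvg_einfs.
apply: nearW => n; apply: (@le_trans _ _ (F n x)%:E).
  by apply: ereal_inf_lbound; exists n => /=.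
by rewrite lee_fin; have /andP[] := FM n x.
Qed.

Lemma lower_limitE x : (lower_limit x)%:E = limn_einf (fun k => (F k x)%:E).
Proof.
have /andP[l0 lM] := einf_range x.
by rewrite /lower_limit fineK// ge0_fin_numE// (le_lt_trans lM)// ltry.
Qed.

Lemma lower_limit_range x : 0 <= lower_limit x <= M.
Proof. by have := einf_range x; rewrite -lower_limitE !lee_fin. Qed.

Lemma measurable_lower_limit : measurable_fun [set: X] lower_limit.
Proof.
apply/measurable_EFinP; rewrite (_ : _ \o _ = fun x => limn_einf (fun k => (F k x)%:E)).
  rewrite /limn_einf; apply: measurableT_comp => //.
  apply: measurable_fun_limn_esup => k.
  by apply: measurableT_comp => //; exact/measurable_EFinP.
by apply/funext => x; rewrite /= lower_limitE.
Qed.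

Lemma lower_limit_cvg x : cvgn (F ^~ x) -> F ^~ x @ \oo --> lower_limit x.
Proof.
move=> /cvg_ex[l Fl].
have /cvg_limn_einf_sup[H _] : (F k x)%:E @[k --> \oo] --> l%:E.
  by apply: cvg_EFin => //; exact: nearW.
by move: H; rewrite -lower_limitE => -[->].
Qed.

Lemma bounded_measurable_lower_limit : bounded_measurable lower_limit.
Proof.
exact: bounded_measurable_range measurable_lower_limit lower_limit_range.
Qed.

Lemma cvg_Rintegral_lower_limit (mu : {finite_measure set X -> \bar R}) (h : X -> R) :
    {ae mu, forall x, cvgn (F ^~ x)} -> bounded_measurable h ->
  \int[mu]_x (F k x * h x) @[k --> \oo] --> \int[mu]_x (lower_limit x * h x).
Proof.
move=> Fcv bh.
have bF k : bounded_measurable (F k) by exact: bounded_measurable_range (mF k) (FM k).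
have bl := bounded_measurable_lower_limit.
have [|||||_ _ cv] := @dominated_convergence _ _ _ mu [set: X] measurableT
  (fun k x => (F k x * h x)%:E) (fun x => (lower_limit x * h x)%:E)
  (fun x => (M * `|h x|)%:E).
- by move=> k; apply/measurable_EFinP; have [] : bounded_measurable (fun x => F k x * h x) by bm.
- by apply/measurable_EFinP; have [] : bounded_measurable (fun x => lower_limit x * h x) by bm.
- apply: filterS Fcv => x Fx _; apply: cvg_EFin; first exact: nearW.
  by apply: cvgM; [exact: lower_limit_cvg | exact: cvg_cst].
- by apply: bounded_measurable_integrable; bm.
- apply: aeW => x k _; rewrite /= lee_fin normrM ler_wpM2r//.
  by have /andP[F0 FMx] := FM k x; rewrite ger0_norm.
by apply: fine_cvg; rewrite fineK; [exact: cv | apply: integrable_fin_num => //; bm].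
Qed.

End lower_limit.

(** A substitute for weak sequential compactness. The convergence holds against
    bounded test functions, which is enough to pass to the limit in linear
    constraints. *)
Lemma convex_class_compactness {d} {X : measurableType d} {R : realType}
    (mu : {finite_measure set X -> \bar R}) (C : nat -> set (X -> R)) (M : R) :
    (forall n, C n !=set0) -> (forall n, C n.+1 `<=` C n) ->
    (forall n, convex_class (C n)) ->
    (forall n f, C n f -> measurable_fun [set: X] f) ->
    (forall n f, C n f -> forall x, 0 <= f x <= M) ->
  exists2 F : nat -> X -> R, forall k, C k (F k) &
    forall h, bounded_measurable h ->
      \int[mu]_x (F k x * h x) @[k --> \oo] --> \int[mu]_x (lower_limit F x * h x).
Proof.
move=> C0 Cdec Cconv Cm CM.
have [F FP] := near_min_norm_sequence mu C0 Cdec Cconv Cm CM.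
have CF k : C k (F k) by have [] := FP k.
exists F => // h bh; apply: cvg_Rintegral_lower_limit => //.
- by move=> k; exact: Cm (CF k).
- by move=> k; exact: CM (CF k).
apply: ae_cvg_of_geometric_increments => k; last by have [] := FP k.
exact: bounded_measurable_range (Cm _ _ (CF k)) (CM _ _ (CF k)).
Qed.

(** * A smooth approximation of the hinge function *)

Section smoothed_hinge.
Context {R : realType}.
Implicit Types c eta x y : R.

(** Opposite of the slope at x of [smoothed_hinge]: it is 0 above c, and 1 below
    c - eta. *)
Definition ramp c eta x : R := Num.max 0 (Num.min 1 ((c - x) / eta)).

(** This is max(0, c - x) smoothed at scale eta: the maximum over p in [0, 1] of
    p (c - x) - (eta / 2) p^2, which is attained at p = ramp c eta x. *)
Definition smoothed_hinge c eta x : R :=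
  ramp c eta x * (c - x) - eta / 2 * ramp c eta x ^+ 2.

Lemma ramp_range c eta x : 0 <= ramp c eta x <= 1.
Proof. by rewrite /ramp le_max lexx/= ge_max ler01 ge_min lexx. Qed.

Let clamp_cases (u : R) :
  [\/ u <= 0 /\ Num.max 0 (Num.min 1 u) = 0,
      [/\ 0 <= u, u <= 1 & Num.max 0 (Num.min 1 u) = u] |
      1 <= u /\ Num.max 0 (Num.min 1 u) = 1].
Proof.
case: (leP 1 u) => [u1|u1]; first by apply: Or33; rewrite max_r.
by case: (leP 0 u) => [u0|/ltW u0]; [apply: Or32; split=> //; exact: ltW | apply: Or31].
Qed.

Let rampE c eta x : 0 < eta ->
  c - x = (c - x) / eta * eta.
Proof. by move=> eta0; rewrite divfK// gt_eqF. Qed.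

Lemma smoothed_hinge_ge0 c eta x : 0 < eta -> 0 <= smoothed_hinge c eta x.
Proof.
move=> eta0; rewrite /smoothed_hinge /ramp {2}(rampE c x eta0).
move: ((c - x) / eta) => u.
have -> (p : R) : p * (u * eta) - eta / 2 * p ^+ 2 = eta * (p * u - p ^+ 2 / 2) by field.
rewrite mulr_ge0 ?(ltW eta0)//.
by case: (clamp_cases u) => [[u0 ->]|[u0 u1 ->]|[u1 ->]]; nra.
Qed.

(** The slope is (1 / eta)-Lipschitz, hence the quadratic upper bound. *)
Lemma smoothed_hinge_expansion c eta x y : 0 < eta ->
  smoothed_hinge c eta y <=
    smoothed_hinge c eta x - ramp c eta x * (y - x) + (y - x) ^+ 2 / (2 * eta).
Proof.
move=> eta0; have eta_neq0 : eta != 0 by rewrite gt_eqF.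
rewrite /smoothed_hinge /ramp.
set u := (c - x) / eta; set v := (c - y) / eta.
have -> : y - x = (u - v) * eta by rewrite /u /v; field.
have -> : c - x = u * eta by rewrite /u; field.
have -> : c - y = v * eta by rewrite /v; field.
set p := Num.max 0 (Num.min 1 u); set q := Num.max 0 (Num.min 1 v).
rewrite -subr_ge0.
have -> : p * (u * eta) - eta / 2 * p ^+ 2 - p * ((u - v) * eta) +
    ((u - v) * eta) ^+ 2 / (2 * eta) - (q * (v * eta) - eta / 2 * q ^+ 2) =
  eta / 2 * ((u - v) ^+ 2 - (q - p) ^+ 2 - 2 * (q - p) * (v - q)) by field.
rewrite mulr_ge0 ?divr_ge0 ?(ltW eta0)//.
have /andP[q0 q1] : 0 <= q <= 1 by rewrite /q le_max lexx/= ge_max ler01 ge_min lexx.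
(* Clamping is the projection onto [0, 1], so u - p points away from q. *)
have pq : 0 <= (u - p) * (p - q).
  by rewrite /p; case: (clamp_cases u) => [[u0 ->]|[u0 u1 ->]|[u1 ->]]; nra.
have := sqr_ge0 (u - p - (v - q)); nra.
Qed.

(** Up to eta, minus the ramp is a subgradient at x of the hinge function
    itself. *)
Lemma hinge_ramp c eta x y : 0 < eta ->
  Num.max 0 (c - x) + ramp c eta x * (x - y) <= Num.max 0 (c - y) + eta.
Proof.
move=> eta0; rewrite /ramp.
have -> : x - y = c - y - (c - x) by ring.
rewrite (rampE c x eta0) mulfK ?gt_eqF//.
move: ((c - x) / eta) (c - y) => u w.
have w0 : 0 <= Num.max 0 w by rewrite le_max lexx.
have w1 : w <= Num.max 0 w by rewrite le_max lexx orbT.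
move: (Num.max 0 w) w0 w1 => w' w0 w1.
case: (clamp_cases u) => [[u0 ->]|[u0 u1 ->]|[u1 ->]].
- have ue : u * eta <= 0 by nra.
  by rewrite (max_l ue); nra.
- have ue : 0 <= u * eta by nra.
  by rewrite (max_r ue); nra.
- have ue : 0 <= u * eta by nra.
  by rewrite (max_r ue); nra.
Qed.
End smoothed_hinge.

(** * Lagrange multipliers *)

Section separation.
Context {d : measure_display} {X : measurableType d} {R : realType}.
Variable mu : {finite_measure set X -> \bar R}.
Implicit Types (e f g h : X -> R) (C : set (X -> R)).

Let total : R := \int[mu]_x 1.

Let total0 : 0 <= total.
Proof. exact: Rintegral_ge0. Qed.

Let Rintegral_const r : \int[mu]_x r = r * total.
Proof.
by rewrite /total -RintegralZl; try bm; apply: eq_Rintegral => x _; rewrite mulr1.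
Qed.

Lemma bounded_measurable_ramp c eta e : bounded_measurable e ->
  bounded_measurable (fun x => ramp c eta (e x)).
Proof. by move=> be; rewrite /ramp; bm. Qed.

Lemma bounded_measurable_smoothed_hinge c eta e : bounded_measurable e ->
  bounded_measurable (fun x => smoothed_hinge c eta (e x)).
Proof.
by move=> /[dup] be /(bounded_measurable_ramp c eta) br; rewrite /smoothed_hinge; bm.
Qed.

(** If e minimizes the smoothed loss up to rho, then moving from e towards f by a
    step t can lower the loss by at most rho. By the quadratic expansion this
    move lowers it by t times the integral of ramp(e) (f - e), up to K t^2. Taking
    rho = t a / 2 and t <= a / (2 (K + 1)) gives the bound a. *)
Lemma smoothed_hinge_near_minimizer C (M c eta a : R) :
    0 < eta -> 0 < a -> C !=set0 -> convex_class C ->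
    (forall e, C e -> measurable_fun [set: X] e) ->
    (forall e, C e -> forall x, 0 <= e x <= M) ->
  exists2 e, C e & forall f, C f ->
    \int[mu]_x (ramp c eta (e x) * (f x - e x)) <= a.
Proof.
move=> eta0 a0 C0 cC mC CM.
have bC e : C e -> bounded_measurable e.
  by move=> Ce; exact: bounded_measurable_range (mC _ Ce) (CM _ Ce).
pose Phi e := \int[mu]_x smoothed_hinge c eta (e x).
pose K := M ^+ 2 / (2 * eta) * total.
have K0 : 0 <= K by rewrite /K mulr_ge0// divr_ge0 ?sqr_ge0// mulr_ge0// ltW.
pose t := Num.min 1 (a / 2 / (K + 1)).
have t0 : 0 < t by rewrite /t lt_min ltr01/= !divr_gt0// ltr_wpDl.
have t1 : t <= 1 by rewrite /t ge_min lexx.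
have tK : t * K <= a / 2.
  have : t * (K + 1) <= a / 2.
    by rewrite -ler_pdivlMr ?ltr_wpDl// /t ge_min lexx orbT.
  by nra.
have Phi_inf : has_inf [set Phi e | e in C].
  split; first by have [e Ce] := C0; exists (Phi e), e.
  by exists 0 => _ [e _ <-]; apply: Rintegral_ge0 => x _; exact: smoothed_hinge_ge0.
have rho0 : 0 < t * (a / 2) by rewrite mulr_gt0// divr_gt0.
have [_ [e Ce <-] emin] := inf_adherent rho0 Phi_inf.
exists e => // f Cf.
have be := bC _ Ce; have bf := bC _ Cf.
have br := bounded_measurable_ramp c eta be.
pose y x := (1 - t) * e x + t * f x.
have Cy : C y by apply: cC => //; rewrite ltW.
have bs := bounded_measurable_smoothed_hinge c eta be.
have bsy := bounded_measurable_smoothed_hinge c eta (bC _ Cy).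
have Phiy : Phi e <= Phi y + t * (a / 2).
  by apply: (le_trans (ltW emin)); rewrite lerD2r; apply: ge_inf; [exact: Phi_inf.2|exists y].
have : Phi y <= \int[mu]_x (smoothed_hinge c eta (e x)
    - t * (ramp c eta (e x) * (f x - e x)) + t ^+ 2 * (M ^+ 2 / (2 * eta))).
  apply: le_Rintegral; try bm; move=> x _.
  apply: le_trans (smoothed_hinge_expansion c (e x) _ eta0) _.
  have -> : y x - e x = t * (f x - e x) by rewrite /y; ring.
  rewrite mulrCA lerD2l exprMn -mulrA ler_wpM2l ?sqr_ge0//.
  rewrite ler_wpM2r ?invr_ge0 ?mulr_ge0 ?(ltW eta0)//.
  by have /andP[? ?] := CM _ Ce x; have /andP[? ?] := CM _ Cf x; nra.
rewrite RintegralD; try bm.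
rewrite RintegralB; try bm.
rewrite RintegralZl; try bm.
rewrite Rintegral_const -mulrA -/K -/(Phi e).
set G := \int[mu]_x _ => PhiG.
have : t * G <= t * (a / 2 + t * K) by lra.
rewrite ler_pM2l//; lra.
Qed.

Variables (C : set (X -> R)) (c : R) (eps : X -> R).
Hypothesis cC : convex_class C.
Hypothesis mC : forall e, C e -> measurable_fun [set: X] e.
Hypothesis Ceps : C eps.
Hypothesis epsc : forall x, eps x <= c.
Hypothesis eps_opt : forall e, C e ->
  \int[mu]_x Num.min (e x) c <= \int[mu]_x eps x.

(** The multiplier is ramp(e) for a near-minimizer e of the smoothed problem. The
    first-order condition compares with e instead of eps; since eps is optimal,
    [hinge_ramp] shows that the integral of ramp(e) (e - eps) is small as well.
    The last inequality says that the integral of (1 - g) (c - eps), a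
    nonnegative function, is almost 0. *)
Lemma approximate_multiplier (M a : R) : 0 < a ->
    (forall e, C e -> forall x, 0 <= e x <= M) ->
  exists g : X -> R, [/\ measurable_fun [set: X] g, forall x, 0 <= g x <= 1,
    forall e, C e -> \int[mu]_x (g x * (e x - eps x)) <= a &
    \int[mu]_x (c - eps x) <= \int[mu]_x (g x * (c - eps x)) + a].
Proof.
move=> a0 CM.
have bC e : C e -> bounded_measurable e.
  by move=> Ce; exact: bounded_measurable_range (mC Ce) (CM _ Ce).
pose eta := a / 2 / (total + 1).
have eta0 : 0 < eta by rewrite !divr_gt0// ltr_wpDl.
have etaT : eta * total <= a / 2.
  have : eta * (total + 1) = a / 2 by rewrite /eta divfK// gt_eqF// ltr_wpDl.
  by nra.
have a20 : 0 < a / 2 by rewrite divr_gt0.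
have [e Ce emin] := smoothed_hinge_near_minimizer c eta0 a20 (ex_intro _ _ Ceps) cC mC CM.
have be := bC _ Ce; have beps := bC _ Ceps.
have bg := bounded_measurable_ramp c eta be.
pose g x := ramp c eta (e x).
have {}bg : bounded_measurable g by [].
have hinge y : bounded_measurable y -> (forall x, y x <= c) ->
    c * total - \int[mu]_x Num.min (e x) c + \int[mu]_x (g x * (e x - y x)) <=
    c * total - \int[mu]_x y x + eta * total.
  move=> by_ yc; rewrite -!Rintegral_const.
  rewrite -!RintegralB; try bm.
  rewrite -!RintegralD; try bm.
  apply: le_Rintegral; try bm; move=> x _.
  have := hinge_ramp c (e x) (y x) eta0.
  rewrite (max_r (_ : 0 <= c - y x)) ?subr_ge0// -/(g x).
  suff -> : Num.max 0 (c - e x) = c - Num.min (e x) c by [].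
  by case: (leP (e x) c) => ec; [rewrite max_r ?subr_ge0|rewrite subrr max_l// subr_le0 ltW].
have bgD h1 h2 : bounded_measurable h1 -> bounded_measurable h2 ->
    \int[mu]_x (g x * (h1 x - h2 x)) = \int[mu]_x (g x * h1 x) - \int[mu]_x (g x * h2 x).
  move=> b1 b2; rewrite -RintegralB; try bm.
  by apply: eq_Rintegral => x _; rewrite mulrBr.
have bc : bounded_measurable (fun _ : X => c) by bm.
have heps := hinge _ beps epsc.
have hc := hinge _ bc (fun=> lexx c).
have opt := eps_opt Ce.
have eeps := emin _ Ceps.
exists g; split; first exact: bg.1.
- by move=> x; exact: ramp_range.
- move=> f Cf; have bf := bC _ Cf; have := emin _ Cf.
  rewrite -/g; move: heps; rewrite !bgD//; lra.
- rewrite RintegralB; try bm.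
  rewrite Rintegral_const; move: hc eeps; rewrite Rintegral_const !bgD//; lra.
Qed.
End separation.

(** The constraints on an approximate multiplier are affine, and with tolerance
    1 / (k + 1) and test e-values bounded by c + k they become stronger as k
    increases. *)
Lemma exact_multiplier {d} {X : measurableType d} {R : realType}
    (mu : {finite_measure set X -> \bar R}) (C : set (X -> R)) (c : R)
    (eps : X -> R) :
    0 <= c -> convex_class C ->
    (forall e, C e -> bounded_measurable e) ->
    (forall e, C e -> forall x, 0 <= e x) ->
    C eps -> (forall x, eps x <= c) ->
    (forall e, C e -> \int[mu]_x Num.min (e x) c <= \int[mu]_x eps x) ->
  exists g : X -> R, [/\ measurable_fun [set: X] g, forall x, 0 <= g x <= 1,
    forall e, C e -> \int[mu]_x (g x * (e x - eps x)) <= 0 &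
    \int[mu]_x (c - eps x) <= \int[mu]_x (g x * (c - eps x))].
Proof.
move=> c0 cC bC C0 Ceps epsc eps_opt.
pose Ck (k : nat) : set (X -> R) := [set e | C e /\ forall x, e x <= c + k%:R].
pose G k : set (X -> R) := [set g : X -> R | [/\ measurable_fun [set: X] g,
    forall x, 0 <= g x <= 1,
    forall e, Ck k e -> \int[mu]_x (g x * (e x - eps x)) <= k.+1%:R^-1 &
    \int[mu]_x (c - eps x) <= \int[mu]_x (g x * (c - eps x)) + k.+1%:R^-1]].
have beps := bC _ Ceps.
have invS k : k.+2%:R^-1 <= k.+1%:R^-1 :> R by rewrite lef_pV2 ?posrE// ler_nat.
have bG k g : G k g -> bounded_measurable g.
  by move=> [mg g01 _ _]; exact: bounded_measurable_range mg g01.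
have G0 k : G k !=set0.
  have k0 : 0 < k.+1%:R^-1 :> R by rewrite invr_gt0.
  have [] := @approximate_multiplier _ _ _ mu (Ck k) c eps _ _ _ _ _ (c + k%:R) _ k0.
  - move=> t e f t01 [Ce ek] [Cf fk]; split; first exact: cC.
    by move=> x; have := ek x; have := fk x; have /andP[? ?] := t01; nra.
  - move=> e [Ce _]; have [me _] := bC _ Ce. exact: me.
  - by split=> // x; rewrite (le_trans (epsc x))// lerDl.
  - exact: epsc.
  - by move=> e [Ce _]; exact: eps_opt.
  - by move=> e [Ce ek] x; rewrite C0 ?ek.
  - by move=> g Gg; exists g.
have Gdec k : G k.+1 `<=` G k.
  move=> g [mg g01 ge gc]; split=> //; last by rewrite (le_trans gc)// lerD2l.
  move=> e [Ce ek]; apply: le_trans (invS k); apply: ge; split=> // x.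
  by rewrite (le_trans (ek x))// lerD2l ler_nat.
have Gcomb g g' t h : bounded_measurable g -> bounded_measurable g' ->
    bounded_measurable h ->
    \int[mu]_x (((1 - t) * g x + t * g' x) * h x) =
    (1 - t) * \int[mu]_x (g x * h x) + t * \int[mu]_x (g' x * h x).
  move=> bg bg' bh; rewrite -!RintegralZl; try bm.
  rewrite -RintegralD; try bm.
  by apply: eq_Rintegral => x _; ring.
have Gconv k : convex_class (G k).
  move=> t g g' /[dup] t01 /andP[t0 t1] Gg Gg'.
  have bg := bG _ _ Gg; have bg' := bG _ _ Gg'.
  have mix (a b r : R) : a <= r -> b <= r -> (1 - t) * a + t * b <= r by move=> *; nra.
  have mix' (a b r : R) : r <= a -> r <= b -> r <= (1 - t) * a + t * b by move=> *; nra.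
  case: Gg Gg' => mg g01 ge gc [mg' g01' ge' gc']; split.
  - by have [] : bounded_measurable (fun x => (1 - t) * g x + t * g' x) by bm.
  - by move=> x; have /andP[? ?] := g01 x; have /andP[? ?] := g01' x; nra.
  - move=> e Cke; have be := bC _ Cke.1; rewrite Gcomb; try bm.
    by apply: mix; [exact: ge | exact: ge'].
  - rewrite Gcomb; try bm.
    rewrite -lerBlDr in gc; rewrite -lerBlDr in gc'.
    by rewrite -lerBlDr; exact: mix'.
have [F FG Fcv] := convex_class_compactness mu G0 Gdec Gconv
  (fun k g Gg => let: And4 mg _ _ _ := Gg in mg)
  (fun k g Gg => let: And4 _ g01 _ _ := Gg in g01).
have mF k : measurable_fun [set: X] (F k) by have [] := FG k.
have F01 k x : 0 <= F k x <= 1 by have [] := FG k.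
have inv0 : (k.+1%:R^-1 : R) @[k --> \oo] --> 0 by exact: cvg_harmonic.
exists (lower_limit F); split.
- exact: measurable_lower_limit.
- exact: lower_limit_range.
- move=> e Ce; have be := bC _ Ce; have [_ [N eN]] := be.
  have bh : bounded_measurable (fun x => e x - eps x) by bm.
  apply: ler_cvg_to (Fcv _ bh) inv0 _.
  (* The constraint for e is imposed on F k once k exceeds the bound N of e. *)
  near=> k; have [_ _ Fe _] := FG k; apply: Fe; split=> // x.
  apply: (le_trans (ler_norm _)); apply: (le_trans (eN x)).
  apply: (@le_trans _ _ k%:R); last by rewrite lerDr.
  by near: k; exact: nbhs_infty_ger.
- have bh : bounded_measurable (fun x => c - eps x) by bm.
  have Fc := cvgD (Fcv _ bh) inv0; rewrite addr0 in Fc.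
  apply: (ler_cvg_to (cvg_cst (\int[mu]_x (c - eps x))) (Fc _)).
  by apply: nearW => k; have [] := FG k.
Unshelve. all: by end_near.
Qed.

(** * Bounded e-values and optimality *)

Section bounded_e_values.
Context {d : measure_display} {X : measurableType d} {R : realType}.
Variable H : set (probability X R).
Implicit Types (e f : X -> R).

Lemma integral_EFin_bounded (mu : {finite_measure set X -> \bar R}) f :
  bounded_measurable f -> (\int[mu]_x (f x)%:E = (\int[mu]_x f x)%:E)%E.
Proof.
by move=> bf; rewrite /Rintegral fineK//; apply: integrable_fin_num => //; bm.
Qed.

Definition bounded_e_value : set (X -> R) :=
  [set e | bounded_measurable e /\ e_value H (EFin \o e)].

Lemma bounded_e_value_ge0 e : bounded_e_value e -> forall x, 0 <= e x.
Proof. by move=> [_ [_ e0 _]] x; have := e0 x; rewrite lee_fin. Qed.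

Lemma bounded_e_value_Rintegral e (P : probability X R) :
  bounded_e_value e -> H P -> \int[P]_x e x <= 1.
Proof. by move=> [be [_ _ eP]] /eP; rewrite integral_EFin_bounded// lee_fin. Qed.

Lemma bounded_e_valueP e : bounded_measurable e -> (forall x, 0 <= e x) ->
  (forall P : probability X R, H P -> \int[P]_x e x <= 1) -> bounded_e_value e.
Proof.
move=> be e0 eP; split=> //; split.
- by apply/measurable_EFinP; exact: be.1.
- by move=> x; rewrite lee_fin.
- by move=> P HP; rewrite integral_EFin_bounded// lee_fin; exact: eP.
Qed.

Lemma bounded_e_value_convex : convex_class bounded_e_value.
Proof.
move=> t e f /andP[t0 t1] He Hf; have [be _] := He; have [bf _] := Hf.
apply: bounded_e_valueP; first by bm.
- move=> x; have := bounded_e_value_ge0 He x; have := bounded_e_value_ge0 Hf x.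
  by nra.
- move=> P HP; rewrite RintegralD; try bm.
  rewrite !RintegralZl; try bm.
  have := bounded_e_value_Rintegral He HP; have := bounded_e_value_Rintegral Hf HP.
  move: (\int[P]_x f x) (\int[P]_x e x) => a b; nra.
Qed.

Lemma bounded_e_value1 : bounded_e_value (fun=> 1).
Proof. by split; [bm | exact: e_value1]. Qed.

Lemma e_value_le (e f : X -> \bar R) : measurable_fun [set: X] f ->
  (forall x, 0 <= f x <= e x)%E -> e_value H e -> e_value H f.
Proof.
move=> mf fe [me e0 eP]; have f0 x : (0 <= f x)%E by have /andP[] := fe x.
split=> // P HP; apply: le_trans (eP _ HP).
by apply: ge0_le_integral => // x _; have /andP[] := fe x.
Qed.

Definition truncation (k : R) (e : X -> \bar R) (x : X) : R := fine (mine (e x) k%:E).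

Lemma truncationE k (e : X -> \bar R) x : 0 <= k -> (0 <= e x)%E ->
  (truncation k e x)%:E = mine (e x) k%:E.
Proof.
move=> k0 e0; rewrite /truncation fineK// ge0_fin_numE ?le_min ?e0 ?lee_fin//.
by rewrite gt_min ltry orbT.
Qed.

Lemma truncation_EFin k e x : truncation k (EFin \o e) x = Num.min (e x) k.
Proof. by rewrite /truncation /= -EFin_min. Qed.

Lemma bounded_e_value_truncation k (e : X -> \bar R) : 0 <= k -> e_value H e ->
  bounded_e_value (truncation k e).
Proof.
move=> k0 He; have [me e0 _] := He.
have tE x : (truncation k e x)%:E = mine (e x) k%:E by exact: truncationE.
have ge0 x : (0 <= mine (e x) k%:E)%E by rewrite le_min e0 lee_fin.
have mt : measurable_fun [set: X] (EFin \o truncation k e).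
  rewrite (_ : _ \o _ = fun x => mine (e x) k%:E); last by apply/funext => x /=.
  by apply: measurable_mine => //; exact: measurable_cst.
split.
- apply: (@bounded_measurable_range _ _ _ k); first exact/measurable_EFinP.
  by move=> x; rewrite -!lee_fin tE ge0/= ge_min lexx orbT.
- apply: e_value_le He => // x /=.
  by rewrite tE ge0 ge_min lexx.
Qed.

Lemma bounded_e_value_min k e : 0 <= k -> bounded_e_value e ->
  bounded_e_value (fun x => Num.min (e x) k).
Proof.
move=> k0 [_ He]; rewrite (_ : (fun x => _) = truncation k (EFin \o e)).
  exact: bounded_e_value_truncation.
by apply/funext => x; rewrite truncation_EFin.
Qed.

(** Fatou's lemma is applied under each P in H separately. *)
Lemma bounded_e_value_lower_limit (F : nat -> X -> R) (M : R) :
    (forall k, bounded_e_value (F k)) -> (forall k x, F k x <= M) ->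
  bounded_e_value (lower_limit F).
Proof.
move=> HF FM.
have mF k : measurable_fun [set: X] (F k) by have [[]] := HF k.
have F0M k x : 0 <= F k x <= M by rewrite FM (bounded_e_value_ge0 (HF k)).
split; first exact: bounded_measurable_lower_limit mF F0M.
have E : EFin \o lower_limit F = fun x => limn_einf (fun k => (F k x)%:E).
  by apply/funext => x; rewrite /= (lower_limitE F0M).
split.
- exact/measurable_EFinP/(measurable_lower_limit mF F0M).
- by move=> x /=; rewrite lee_fin; have /andP[] := lower_limit_range F0M x.
move=> P HP; rewrite E.
apply: (@le_trans _ _ (limn_einf (fun k => \int[P]_x (F k x)%:E)%E)).
  apply: (@fatou _ _ _ P [set: X] measurableT (fun k x => (F k x)%:E)).
  - by move=> k; exact/measurable_EFinP.
  - by move=> k x _; rewrite lee_fin (bounded_e_value_ge0 (HF k)).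
rewrite limn_einf_lim; apply: lime_le; first exact: is_cvg_einfs.
apply: nearW => n; apply: (@le_trans _ _ (\int[P]_x (F n x)%:E)%E).
  by apply: ereal_inf_lbound; exists n => /=.
by have [_ [_ _]] := HF n; apply.
Qed.

Variable mu : {finite_measure set X -> \bar R}.

Lemma exists_optimal_bounded_e_value (c : R) : 0 <= c ->
  exists eps, [/\ bounded_e_value eps, forall x, eps x <= c &
    forall e, bounded_e_value e -> \int[mu]_x Num.min (e x) c <= \int[mu]_x eps x].
Proof.
move=> c0.
pose E : set (X -> R) := [set e | bounded_e_value e /\ forall x, e x <= c].
have bE e : E e -> bounded_measurable e by move=> [[]].
pose V := [set \int[mu]_x e x | e in E].
have supV : has_sup V.
  split.
    exists (\int[mu]_x Num.min 1 c), (fun=> Num.min 1 c) => //; split.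
      exact: (bounded_e_value_min c0 bounded_e_value1).
    by move=> x; rewrite ge_min lexx orbT.
  exists (\int[mu]_x c) => _ [e Ee <-]; have be := bE _ Ee.
  by apply: le_Rintegral; try bm; move=> x _; case: Ee.
pose C (k : nat) : set (X -> R) :=
  [set e | E e /\ sup V - k.+1%:R^-1 <= \int[mu]_x e x].
have [||||| F FC Fcv] := @convex_class_compactness _ _ _ mu C c.
- move=> k; have k0 : 0 < k.+1%:R^-1 :> R by rewrite invr_gt0.
  have [_ [e Ee <-] lte] := sup_adherent k0 supV.
  by exists e; split=> //; exact: ltW.
- move=> k e [Ee Ve]; split=> //; apply: le_trans Ve.
  by rewrite lerD2l lerN2 lef_pV2 ?posrE// ler_nat.
- move=> k t e f /[dup] t01 /andP[t0 t1] [Ee Ve] [Ef Vf].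
  have be := bE _ Ee; have bf := bE _ Ef; split.
    split; first exact: bounded_e_value_convex Ee.1 Ef.1.
    by move=> x; have := Ee.2 x; have := Ef.2 x; nra.
  rewrite RintegralD; try bm.
  rewrite !RintegralZl; try bm.
  move: Ve Vf; move: (\int[mu]_x f x) (\int[mu]_x e x) (sup V - _) => a b r; nra.
- by move=> k e [/bE[]].
- by move=> k e [[He ec] _] x; rewrite ec (bounded_e_value_ge0 He).
have HF k : bounded_e_value (F k) by have [[]] := FC k.
have Fc k x : F k x <= c by have [[_ ->]] := FC k.
have F0c k x : 0 <= F k x <= c by rewrite Fc (bounded_e_value_ge0 (HF k)).
exists (lower_limit F); split; first exact: bounded_e_value_lower_limit HF Fc.
- by move=> x; have /andP[] := lower_limit_range F0c x.
move=> e He; apply: (@le_trans _ _ (sup V)).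
  apply: sup_upper_bound => //; exists (fun x => Num.min (e x) c) => //.
  split; first exact: bounded_e_value_min.
  by move=> x; rewrite ge_min lexx orbT.
have inv0 : (k.+1%:R^-1 : R) @[k --> \oo] --> 0 by exact: cvg_harmonic.
have b1 : bounded_measurable (fun _ : X => 1 : R) by bm.
have cvF := cvgD (Fcv _ b1) inv0; rewrite addr0 in cvF.
have -> : \int[mu]_x lower_limit F x = \int[mu]_x (lower_limit F x * 1).
  by apply: eq_Rintegral => x _; rewrite mulr1.
apply: (ler_cvg_to (cvg_cst (sup V)) (cvF _)); apply: nearW => k.
rewrite -lerBlDr; apply: (le_trans (FC k).2).
by rewrite le_eqVlt; apply/orP; left; apply/eqP; apply: eq_Rintegral => x _; rewrite mulr1.
Qed.

(** Truncating an e-value at 1 / alpha changes neither its utility nor its being an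
    e-value, and makes every expectation finite. *)
Lemma U_optimal_NPP (alpha : R) eps : 0 < alpha -> bounded_e_value eps ->
    (forall x, eps x <= alpha^-1) ->
  U_optimal (U_NP alpha) H mu (EFin \o eps) <->
  forall e, bounded_e_value e ->
    \int[mu]_x Num.min (e x) alpha^-1 <= \int[mu]_x eps x.
Proof.
move=> alpha0 Heps epsc; have c0 : 0 <= alpha^-1 by rewrite invr_ge0 ltW.
have beps := Heps.1.
have Ueps x : U_NP alpha (eps x)%:E = (eps x)%:E by rewrite /U_NP min_l// lee_fin.
split=> [[_ opt] e He|opt].
  have be := He.1; have [_] := opt _ He.2.
  under eq_integral do rewrite /= Ueps /U_NP -EFin_min -EFinB.
  rewrite integral_EFin_bounded; last by bm.
  rewrite lee_fin RintegralB; try bm.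
  by rewrite subr_ge0.
split; first exact: Heps.2.
move=> e He; have [_ e0 _] := He.
have Ht := bounded_e_value_truncation c0 He; have bt := Ht.1.
have UE x : U_NP alpha (e x) = (truncation alpha^-1 e x)%:E by rewrite truncationE.
have UB : ((U_NP alpha \o (EFin \o eps)) \- (U_NP alpha \o e) =
    EFin \o (fun x => eps x - truncation alpha^-1 e x)%R)%E.
  by apply/funext => x /=; rewrite Ueps UE.
split; first split.
- by apply: aeW => x /=; rewrite Ueps UE.
- by left; rewrite UB; apply: integral_funepos_lt_pinfty; bm.
under eq_integral do rewrite /= Ueps UE -EFinB.
rewrite integral_EFin_bounded; last by bm.
rewrite lee_fin RintegralB; try bm.
rewrite subr_ge0; apply: le_trans (opt _ Ht).
by rewrite le_eqVlt; apply/orP; left; apply/eqP; apply: eq_Rintegral => x _;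
  rewrite min_l// -lee_fin truncationE// ge_min lexx orbT.
Qed.

End bounded_e_values.

(** * Measures with a bounded density *)

Section density.
Context {d : measure_display} {X : measurableType d} {R : realType}.
Variable mu : {finite_measure set X -> \bar R}.
Implicit Types (e f w : X -> R).

Lemma ae_integral_ge0 (f : X -> \bar R) : measurable_fun [set: X] f ->
  {ae mu, forall x, (0 <= f x)%E} -> (0 <= \int[mu]_x f x)%E.
Proof.
move=> mf f0; rewrite (@ae_eq_integral _ _ _ mu [set: X] (f^\+)%E)//.
- by apply: integral_ge0 => x _.
- exact: measurable_funepos.
- by apply: filterS f0 => x fx _; rewrite funeposE max_l.
Qed.

Lemma ae_eq0_of_Rintegral_le0 f : bounded_measurable f -> (forall x, 0 <= f x) ->
  \int[mu]_x f x <= 0 -> {ae mu, forall x, f x = 0}.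
Proof.
move=> bf f0 intf.
have mf : measurable_fun [set: X] (EFin \o f) by apply/measurable_EFinP; exact: bf.1.
have [+ _] := ae_eq_integral_abs mu measurableT mf.
have -> : (\int[mu]_x `|(EFin \o f) x| = 0)%E.
  under eq_integral do rewrite /= ger0_norm//.
  by rewrite integral_EFin_bounded//; congr _%:E; apply/eqP; rewrite eq_le intf Rintegral_ge0.
by move=> /(_ erefl); apply: filterS => x /(_ Logic.I) [].
Qed.

Lemma exists_density_measure w : bounded_measurable w -> (forall x, 0 <= w x) ->
  exists P : {finite_measure set X -> \bar R},
    forall A, measurable A -> P A = (\int[mu]_(x in A) (w x)%:E)%E.
Proof.
move=> bw w0.
have iw : mu.-integrable [set: X] (EFin \o w) by bm.
have nu0 A : (0 <= induced_charge iw A)%E by apply: integral_ge0 => x _; rewrite lee_fin.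
pose nu := measure_of_charge _ nu0.
have nufin : (nu [set: X] < +oo)%E.
  by rewrite -ge0_fin_numE; [exact: integrable_fin_num | exact: nu0].
(* Restricting to the whole space turns nu into a finite measure. *)
exists (mfrestr measurableT nufin) => A mA.
by rewrite /= /mfrestr /mrestr setIT.
Qed.

Variables (w : X -> R) (P : {finite_measure set X -> \bar R}).
Hypothesis bw : bounded_measurable w.
Hypothesis PE : forall A, measurable A -> P A = (\int[mu]_(x in A) (w x)%:E)%E.

Lemma density_dominates : P `<< mu.
Proof.
apply/null_content_dominatesP => A mA A0; rewrite PE//.
apply: null_set_integral => //.
by apply/measurable_EFinP; apply: measurable_funTS; exact: bw.1.
Qed.

Local Open Scope charge_scope.

Lemma ae_eq_Radon_Nikodym_density :
  ae_eq mu [set: X] ('d (charge_of_finite_measure P) '/d mu) (EFin \o w).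
Proof.
apply: integral_ae_eq => //.
- apply: Radon_Nikodym_integrable; exact: density_dominates.
- by apply/measurable_EFinP; exact: bw.1.
- move=> A _ mA; rewrite -Radon_Nikodym_integral//; [exact: PE | exact: density_dominates].
Qed.

Lemma Rintegral_density e : bounded_measurable e ->
  \int[P]_x e x = \int[mu]_x (e x * w x).
Proof.
move=> be; congr fine.
rewrite -(Radon_Nikodym_change_of_variables density_dominates)//; last by bm.
apply: ae_eq_integral => //.
- apply: emeasurable_funM; first by apply/measurable_EFinP; exact: be.1.
  by apply: measurable_int; apply: Radon_Nikodym_integrable; exact: density_dominates.
- by apply/measurable_EFinP; have [] : bounded_measurable (fun x => e x * w x) by bm.
- by apply: filterS ae_eq_Radon_Nikodym_density => x /(_ Logic.I) -> _.
Qed.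

End density.

Section effective_hypothesis.
Context {d : measure_display} {X : measurableType d} {R : realType}.
Variables (H : set (probability X R)) (P : {finite_measure set X -> \bar R}).

(** An e-value is the increasing limit of its truncations at integers, which are
    bounded e-values. *)
Lemma effective_hypothesisP :
  (forall e, bounded_e_value H e -> \int[P]_x e x <= 1) ->
  effective_hypothesis H P.
Proof.
move=> bP e He; have [me e0 _] := He.
pose t (n : nat) x : \bar R := (truncation n%:R e x)%:E.
have Ht n := bounded_e_value_truncation (ler0n R n) He.
have tE n x : t n x = mine (e x) n%:R%:E by apply: truncationE.
have t_cvg x : t ^~ x @ \oo --> e x.
  have -> : t ^~ x = fun n => mine (e x) n%:R%:E by apply/funext => n; exact: tE.
  have := e0 x; case: (e x) => [r| |] // r0; last first.
    by under eq_fun do rewrite min_r ?leey//; exact/cvgeryP/cvgr_idn.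
  apply: cvg_near_cst; near=> n; rewrite min_l// lee_fin.
  by near: n; exact: nbhs_infty_ger.
have -> : (\int[P]_x e x = \int[P]_x limn (t ^~ x))%E.
  by apply: eq_integral => x _; apply/esym/cvg_lim.
have [mt t0 t_nd] : [/\ forall n, measurable_fun [set: X] (t n),
    forall n x, [set: X] x -> (0 <= t n x)%E &
    forall x, [set: X] x -> nondecreasing_seq (t ^~ x)].
  split.
  - by move=> n; apply/measurable_EFinP; have [[]] := Ht n.
  - by move=> n x _; rewrite lee_fin (bounded_e_value_ge0 (Ht n)).
  - move=> x _ m n mn; rewrite !tE le_min ge_min lexx/= ge_min.
    by rewrite lee_fin ler_nat mn orbT.
rewrite monotone_convergence//; apply: lime_le.
  by apply: ereal_nondecreasing_is_cvgn => m n mn; apply: ge0_le_integral => //;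
    move=> x Xx; [exact: t0 | exact: t_nd].
apply: nearW => n.
by rewrite integral_EFin_bounded ?lee_fin; [exact: bP | have [] := Ht n].
Unshelve. all: by end_near.
Qed.

End effective_hypothesis.

(** * The Neyman-Pearson form *)

Section multipliers.
Context {d : measure_display} {X : measurableType d} {R : realType}.
Variables (H : set (probability X R)) (mu : {finite_measure set X -> \bar R}).
Variables (c : R) (eps : X -> R).
Hypothesis Heps : bounded_e_value H eps.
Hypothesis epsc : forall x, eps x <= c.
Local Open Scope charge_scope.

(** With g the exact multiplier, lambda the integral of g eps and P = (g / lambda) mu,
    the ratio r equals g, also when lambda = 0: then P = 0, and g = 0 almost everywhere
    because the constant 1 is an e-value. Complementary slackness is the choice of
    lambda, and eps = c where r < 1 because (1 - g) (c - eps) has integral 0. *)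
Lemma multiplier_of_optimal : 0 <= c ->
    (forall e, bounded_e_value H e ->
      \int[mu]_x Num.min (e x) c <= \int[mu]_x eps x) ->
  exists (P : {finite_measure set X -> \bar R}) (lambda : R),
    [/\ effective_hypothesis H P /\ P `<< mu, 0 <= lambda,
        {ae mu, forall x,
          let r := (lambda%:E * ('d (charge_of_finite_measure P) '/d mu) x)%E in
          (r <= 1)%E /\ ((r < 1)%E -> eps x = c)} &
        lambda * (\int[P]_x eps x - 1) = 0].
Proof.
move=> c0 opt; have beps := Heps.1; have eps0 := bounded_e_value_ge0 Heps.
have bHe e : bounded_e_value H e -> bounded_measurable e by case.
have [g [mg g01 ge gc]] := exact_multiplier c0 (@bounded_e_value_convex _ _ _ H)
  bHe (@bounded_e_value_ge0 _ _ _ H) Heps epsc opt.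
have g0 x : 0 <= g x by have /andP[] := g01 x.
have bg := bounded_measurable_range mg g01.
pose lambda := \int[mu]_x (g x * eps x).
have lambda0 : 0 <= lambda by apply: Rintegral_ge0 => x _; rewrite mulr_ge0.
have gle e : bounded_e_value H e -> \int[mu]_x (g x * e x) <= lambda.
  move=> He; have be := bHe _ He; rewrite -subr_le0 -RintegralB; try bm.
  by apply: le_trans (ge _ He); under eq_Rintegral do rewrite -mulrBr.
pose w x := lambda^-1 * g x.
have bw : bounded_measurable w by rewrite /w; bm.
have w0 x : 0 <= w x by rewrite mulr_ge0// invr_ge0.
have [P PE] := exists_density_measure mu bw w0.
have P_int e : bounded_measurable e ->
    \int[P]_x e x = lambda^-1 * \int[mu]_x (g x * e x).
  move=> be; rewrite (Rintegral_density bw PE be) -RintegralZl; try bm.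
  by apply: eq_Rintegral => x _; rewrite /w; ring.
have lambda_g : {ae mu, forall x, lambda * w x = g x}.
  have [l0|l0] := eqVneq lambda 0; last by apply: aeW => x; rewrite /w mulVKf.
  have g_le0 : \int[mu]_x g x <= 0.
    rewrite -l0; apply: le_trans (gle _ (bounded_e_value1 H)).
    by under [leRHS]eq_Rintegral do rewrite mulr1.
  by apply: filterS (ae_eq0_of_Rintegral_le0 bg g0 g_le0) => x ->; rewrite l0 mul0r.
have slack : {ae mu, forall x, (1 - g x) * (c - eps x) = 0}.
  apply: ae_eq0_of_Rintegral_le0; first by bm.
    by move=> x; have /andP[? ?] := g01 x; rewrite mulr_ge0 ?subr_ge0.
  under eq_Rintegral do rewrite mulrBl mul1r.
  by rewrite RintegralB; try bm; rewrite subr_le0.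
exists P, lambda; split=> //; first split.
- apply: effective_hypothesisP => e He; rewrite P_int; last exact: bHe.
  have [->|l0] := eqVneq lambda 0; first by rewrite invr0 mul0r.
  rewrite mulrC ler_pdivrMr ?mul1r; first exact: gle.
  by rewrite lt_neqAle eq_sym l0.
- exact: density_dominates bw PE.
- have rn := ae_eq_Radon_Nikodym_density bw PE.
  apply: filterS3 rn lambda_g slack => x /(_ Logic.I) -> lg sl /=.
  rewrite -EFinM lg lee_fin lte_fin; split; first by have /andP[] := g01 x.
  move=> g1; move/eqP: sl; rewrite mulf_eq0 subr_eq0 (gt_eqF g1)/= subr_eq0.
  by move=> /eqP.
- rewrite P_int// mulrBr mulr1; have [->|l0] := eqVneq lambda 0; first by rewrite mul0r subrr.
  by rewrite mulVKf// subrr.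
Qed.

(** In each of the cases r < 1, r = 1 and r > 1, the product of eps - min(e, c) and
    1 - r is nonnegative. The mu-integral of r times the first factor is lambda
    times its P-integral, by change of variables. *)
Lemma optimal_of_multiplier (P : {finite_measure set X -> \bar R}) (lambda : R) :
    0 <= c -> effective_hypothesis H P -> P `<< mu -> 0 <= lambda ->
    {ae mu, forall x,
      let r := (lambda%:E * ('d (charge_of_finite_measure P) '/d mu) x)%E in
      ((r < 1)%E -> eps x = c) /\ ((1 < r)%E -> eps x = 0)} ->
    lambda * (\int[P]_x eps x - 1) = 0 ->
  forall e, bounded_e_value H e ->
    \int[mu]_x Num.min (e x) c <= \int[mu]_x eps x.
Proof.
move=> c0 HP Pmu lambda0 eps_r slack e He; have beps := Heps.1.
set h := 'd _ '/d _ in eps_r.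
have Hf := bounded_e_value_min c0 He; have bf := Hf.1.
have f0 := bounded_e_value_ge0 Hf.
set f := (fun x => Num.min (e x) c) in Hf bf f0 *.
have fP : \int[P]_x f x <= 1.
  by have := HP _ Hf.2; rewrite integral_EFin_bounded// lee_fin.
have hfin x : h x \is a fin_num by apply: Radon_Nikodym_fin_num.
pose D x := eps x - f x.
have bD : bounded_measurable D by rewrite /D; bm.
have iD : P.-integrable [set: X] (EFin \o D) by bm.
have mh : measurable_fun [set: X] h.
  by apply: measurable_int; exact: Radon_Nikodym_integrable.
have iDh : mu.-integrable [set: X] (fun x => (D x)%:E * h x)%E.
  have ih : mu.-integrable [set: X] h by exact: Radon_Nikodym_integrable.
  have [M DM] := bD.2.
  apply: (@le_integrable _ _ _ mu [set: X] measurableT _ (fun x => M%:E * h x)%E).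
  - by apply: emeasurable_funM => //; apply/measurable_EFinP; exact: bD.1.
  - move=> x _; rewrite !abseM lee_wpmul2r// lee_fin.
    by rewrite (le_trans (DM x))// ler_norm.
  - exact: integrableZl.
have DP : (\int[mu]_x ((D x)%:E * h x) = (\int[P]_x D x)%:E)%E.
  by rewrite (Radon_Nikodym_change_of_variables Pmu)// -integral_EFin_bounded.
have ge0 : (0 <= \int[mu]_x ((D x)%:E - lambda%:E * ((D x)%:E * h x)))%E.
  apply: ae_integral_ge0.
    apply: emeasurable_funB; first by apply/measurable_EFinP; exact: bD.1.
    by apply: emeasurable_funM => //; exact: (measurable_int mu).
  apply: filterS eps_r => x /=; rewrite -(fineK (hfin x)) -!EFinM -EFinB.
  rewrite !lte_fin lee_fin; move: (fine (h x)) => y [lt1 gt1].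
  have -> : D x - lambda * (D x * y) = D x * (1 - lambda * y) by ring.
  rewrite /D; have [ry|ry|->] := ltgtP (lambda * y) 1.
  - by rewrite lt1// mulr_ge0 ?subr_ge0 ?(ltW ry)// ge_min lexx orbT.
  - by rewrite gt1// sub0r mulr_le0 ?oppr_le0 ?subr_le0 ?(ltW ry)// f0.
  - by rewrite subrr mulr0.
rewrite integralB// in ge0; [|by bm|exact: integrableZl].
rewrite integralZl// DP integral_EFin_bounded// -EFinM -EFinB lee_fin in ge0.
rewrite -subr_ge0 -RintegralB; try bm.
apply: (le_trans (_ : 0 <= lambda * \int[P]_x D x)); last by rewrite -subr_ge0.
rewrite RintegralB; try bm.
have -> : lambda * (\int[P]_x eps x - \int[P]_x f x) = lambda * (1 - \int[P]_x f x).
  by move: slack; move: (\int[P]_x eps x) (\int[P]_x f x) => a b; lra.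
by rewrite mulr_ge0// subr_ge0.
Qed.
End multipliers.

Local Open Scope charge_scope.
Local Open Scope ereal_scope.

Theorem corollary6 (d : measure_display) (X : measurableType d) (R : realType)
    (alpha : R) (halpha0 : (0 < alpha)%R) (halpha1 : (alpha < 1)%R)
    (H : set (probability X R)) (Q : probability X R)
    (Qa : {finite_measure set X -> \bar R}) (Qs : {measure set X -> \bar R})
    (hQ : generalized_lebesgue_decomposition H Q Qa Qs) :
  (exists2 e : X -> \bar R,
     U_optimal (U_NP alpha) H Qa e &
     forall x, 0 <= e x <= (alpha^-1)%:E) /\
  (forall eNP : X -> \bar R,
     e_value H eNP ->
     (forall x, 0 <= eNP x <= (alpha^-1)%:E) ->
     (U_optimal (U_NP alpha) H Qa eNP <->
      exists (P : {finite_measure set X -> \bar R}) (lambda : R)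
             (kappa : X -> R),
        [/\ effective_hypothesis H P /\ P `<< Qa,
            (0 <= lambda)%R,
            measurable_fun [set: X] kappa /\
              (forall x, 0 <= kappa x <= alpha^-1)%R,
            {ae Qa, forall x,
               let r := lambda%:E *
                        ('d (charge_of_finite_measure P) '/d Qa) x in
               [/\ r < 1 -> eNP x = (alpha^-1)%:E,
                   r = 1 -> eNP x = (kappa x)%:E &
                   1 < r -> eNP x = 0]} &
            lambda%:E * (\int[P]_x eNP x - 1) = 0])).
Proof.
have c0 : (0 <= alpha^-1)%R by rewrite invr_ge0 ltW.
split.
  have [eps [Heps epsc opt]] := exists_optimal_bounded_e_value H Qa c0.
  exists (EFin \o eps); first by apply/U_optimal_NPP.
  by move=> x /=; rewrite !lee_fin epsc (bounded_e_value_ge0 Heps).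
move=> eNP He eNPc.
pose eps := truncation alpha^-1 eNP.
have Heps : bounded_e_value H eps by exact: bounded_e_value_truncation.
have eNPE : eNP = EFin \o eps.
  apply/funext => x /=; have /andP[x0 xc] := eNPc x.
  by rewrite truncationE// min_l.
have epsc x : (eps x <= alpha^-1)%R.
  by have /andP[_] := eNPc x; rewrite eNPE lee_fin.
have beps := Heps.1; have eps0 := bounded_e_value_ge0 Heps.
have slackE (P : {finite_measure set X -> \bar R}) (lambda : R) :
    lambda%:E * (\int[P]_x (EFin \o eps) x - 1) =
    (lambda * ((\int[P]_x eps x)%R - 1))%:E.
  by rewrite integral_EFin_bounded// -EFinB -EFinM.
rewrite eNPE U_optimal_NPP//; split=> [opt|].
  have [P [lambda [HP lambda0 epsr slack]]] := multiplier_of_optimal Heps epsc c0 opt.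
  exists P, lambda, eps; split=> //.
  - by split=> [|x]; [exact: beps.1 | rewrite eps0 epsc].
  - apply: filterS epsr => x /= [r1 lt1]; split=> // [/lt1 -> //|].
    by rewrite ltNge r1.
  - by rewrite slackE slack.
move=> [P [lambda [kappa [[HP Pmu] lambda0 _ epsr]]]].
rewrite slackE => /eqP; rewrite eqe => /eqP slack.
apply: (optimal_of_multiplier Heps c0 HP Pmu lambda0 _ slack).
by apply: filterS epsr => x /= [lt1 _ gt1]; split=> [/lt1 []|/gt1 []].
Qed.
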